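(* Let $G=(V,E)$ be a finite signed undirected graph with $V=\{1,\dots,n\}$, $E=E^+\sqcup E^-$, such that the positive subgraph $G^+=(V,E^+)$ is connected and the negative edge set $E^-$ is nonempty. For $\alpha,\beta\ge 0$ consider the dynamics on $x(t)=(x_1(t),\dots,x_n(t))^\top\in\mathbb{R}^n$, $t=0,1,2,\dots$, $$x_i(t+1)=x_i(t)+\alpha\sum_{j\in N_i^+}\big(x_j(t)-x_i(t)\big)-\beta\sum_{j\in N_i^-}\big(x_j(t)-x_i(t)\big),\qquad i\in V.$$ Then for every $\alpha$ with $0<\alpha<1/\max_{i\in V}\deg_i^+$ there exists a critical value $\beta_*\ge 0$ such that: (i) if $\beta<\beta_*$, then $\lim_{t\to\infty}x_i(t)=\frac1n\sum_{j=1}^n x_j(0)$ for every $i\in V$ and every initial value $x(0)\in\mathbb{R}^n$; (ii) if $\beta>\beta_*$, then $\lim_{t\to\infty}\|x(t)\|=\infty$ for Lebesgue-almost every initial value $x(0)\in\mathbb{R}^n$.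
   Context: A signed graph is an undirected simple graph whose edge set is partitioned into positive edges $E^+$ and negative edges $E^-$. For a node $i$, $N_i^+=\{j:\{i,j\}\in E^+\}$ and $N_i^-=\{j:\{i,j\}\in E^-\}$ are its positive and negative neighbor sets, and $\deg_i^+=|N_i^+|$ is its positive degree. *)

(* Defs.v *)
From HB Require Import structures.
From mathcomp Require Import all_boot all_order all_algebra.
From mathcomp Require Import all_classical all_reals all_analysis.
Set Implicit Arguments. Unset Strict Implicit. Unset Printing Implicit Defensive.
Import Order.TTheory GRing.Theory Num.Theory.
Import numFieldNormedType.Exports.
Local Open Scope classical_set_scope.
Local Open Scope ring_scope.

Section SignedGraph.
Variables (R : realType) (n : nat) (Ep Em : rel 'I_n).

Definition degp (i : 'I_n) : nat := #|[set j | Ep i j]|.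

Definition maxdegp : nat := (\max_(i < n) degp i)%N.

Definition step (alpha beta : R) (x : 'I_n -> R) : 'I_n -> R :=
  fun i => x i + alpha * (\sum_(j | Ep i j) (x j - x i))
               - beta * (\sum_(j | Em i j) (x j - x i)).

Definition traj (alpha beta : R) (x0 : 'I_n -> R) (t : nat) : 'I_n -> R :=
  iter t (step alpha beta) x0.

End SignedGraph.

Definition avg (R : realType) (n : nat) (x : 'I_n -> R) : R :=
  (\sum_(j < n) x j) / n%:R.

Definition eucl_norm (R : realType) (n : nat) (x : 'I_n -> R) : R :=
  Num.sqrt (\sum_(i < n) x i ^+ 2).

Definition box (R : realType) (n : nat) (a b : 'I_n -> R) : set ('I_n -> R) :=
  [set x | forall i, a i <= x i <= b i].

Definition lebesgue_null (R : realType) (n : nat) (A : set ('I_n -> R)) : Prop :=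
  forall eps : R, 0 < eps ->
    exists a b : nat -> 'I_n -> R,
      [/\ (forall k i, a k i <= b k i),
          A `<=` \bigcup_k box (a k) (b k)
        & forall N : nat, \sum_(k < N) \prod_(i < n) (b k i - a k i) <= eps].

(* Main.v *)
Require Import Defs.
From HB Require Import structures.
From mathcomp Require Import all_boot all_order all_algebra.
From mathcomp Require Import all_classical all_reals all_analysis.
From mathcomp Require Import ring lra.
Import Order.TTheory GRing.Theory Num.Theory.
Import numFieldNormedType.Exports.
Set Implicit Arguments. Unset Strict Implicit. Unset Printing Implicit Defensive.
Local Open Scope classical_set_scope.
Local Open Scope ring_scope.

(* Let [q+] and [q-] be the energies (sums of squared differences over edges) of
   the positive and negative subgraphs. The update matrix [A] is symmetric, fixes
   the constant vectors, and has the form [<x, x A> = |x|^2 - alpha q+ + beta q-].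
   The critical value is [beta_* = inf alpha q+ / q-] over [q- > 0].
   - If [beta < beta_*], then [alpha q+ - beta q-] dominates a multiple of [q+],
     which is coercive on vectors of sum zero since the positive subgraph is
     connected; with [alpha < 1 / max deg+] this gives [|<x, x A>| <= rho |x|^2]
     there with [rho < 1], so by symmetry [A] contracts the deviation from the
     average.
   - If [beta > beta_*], then [<x, x A> > |x|^2] for some [x], so [A] has an
     eigenvector [v] with eigenvalue [> 1], and the trajectory diverges from every
     initial value off the hyperplane orthogonal to [v]. *)

(** * Symmetric matrices *)

Section Dot.
Variables (R : realType) (n : nat).
Implicit Types (x y z v w : 'rV[R]_n) (A B : 'M[R]_n).

Definition dot x y : R := (x *m y^T) 0 0.

Lemma dotE x y : dot x y = \sum_i x 0 i * y 0 i.
Proof. by rewrite /dot mxE; apply: eq_bigr => i _; rewrite mxE. Qed.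

Lemma dotC x y : dot x y = dot y x.
Proof. by rewrite !dotE; apply: eq_bigr => i _; rewrite mulrC. Qed.

Lemma dotDl x y z : dot (x + y) z = dot x z + dot y z.
Proof. by rewrite /dot mulmxDl mxE. Qed.

Lemma dotZl a x y : dot (a *: x) y = a * dot x y.
Proof. by rewrite /dot -scalemxAl mxE. Qed.

Lemma dotDr x y z : dot x (y + z) = dot x y + dot x z.
Proof. by rewrite dotC dotDl !(dotC x). Qed.

Lemma dotZr a x y : dot x (a *: y) = a * dot x y.
Proof. by rewrite dotC dotZl dotC. Qed.

Lemma dotNl x y : dot (- x) y = - dot x y.
Proof. by rewrite -scaleN1r dotZl mulN1r. Qed.

Lemma dotNr x y : dot x (- y) = - dot x y.
Proof. by rewrite dotC dotNl dotC. Qed.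

Definition dot_lin := (dotDl, dotDr, dotNl, dotNr, dotZl, dotZr).

Lemma dot_mulmxr x y A : dot x (y *m A) = dot (x *m A^T) y.
Proof. by rewrite /dot trmx_mul mulmxA. Qed.

Lemma dot_ge0 x : 0 <= dot x x.
Proof. by rewrite dotE sumr_ge0 // => i _; rewrite -expr2 sqr_ge0. Qed.

Lemma sqr_coord_le_dot x i : x 0 i ^+ 2 <= dot x x.
Proof.
rewrite dotE (bigD1 i) //= -expr2 lerDl sumr_ge0 // => j _.
by rewrite -expr2 sqr_ge0.
Qed.

Lemma dot_eq0 x : (dot x x == 0) = (x == 0).
Proof.
apply/eqP/eqP => [x0|->]; last by rewrite /dot mul0mx mxE.
apply/rowP => i; rewrite mxE; apply/eqP; rewrite -sqrf_eq0 eq_le sqr_ge0 andbT.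
by rewrite -x0 sqr_coord_le_dot.
Qed.

Lemma dot_gt0 x : x != 0 -> 0 < dot x x.
Proof. by move=> x0; rewrite lt_def dot_eq0 x0 dot_ge0. Qed.

Lemma dot_Cauchy_Schwarz x y : dot x y ^+ 2 <= dot x x * dot y y.
Proof.
have [->|y0] := eqVneq y 0; first by rewrite /dot !(trmx0, mulmx0) mxE expr0n mulr0.
have yy := dot_gt0 y0.
have := dot_ge0 (dot y y *: x - dot x y *: y).
rewrite !dot_lin (dotC y x) => h.
have {h} : 0 <= dot y y * (dot x x * dot y y - dot x y ^+ 2) by move: h; nra.
by rewrite pmulr_rge0 // subr_ge0.
Qed.

Lemma mulmx_bounded A :
  exists2 c : R, 0 < c & forall x, dot (x *m A) (x *m A) <= c * dot x x.
Proof.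
(* The sum is the squared Frobenius norm of [A], by Cauchy-Schwarz on each column; the added 1 keeps
   [c] positive when [A] is 0. *)
exists (1 + \sum_i dot (row i A^T) (row i A^T)).
  by rewrite ltr_pwDl // sumr_ge0 // => i _; exact: dot_ge0.
move=> x; rewrite mulrDl mul1r ler_wpDl ?dot_ge0 // [leLHS]dotE mulr_suml.
apply: ler_sum => i _; rewrite mulrC -expr2.
have -> : (x *m A) 0 i = dot (row i A^T) x.
  by rewrite dotE mxE; apply: eq_bigr => j _; rewrite !mxE mulrC.
exact: dot_Cauchy_Schwarz.
Qed.

(* Polarization: [4 <x, y A> = q(x + y) - q(x - y)] for [q z = <z, z A>], used
   with [y = rho^-1 x A]. *)
Lemma numerical_radius_contraction A w (rho : R) :
    A^T = A -> w *m A = w -> 0 < rho ->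
    (forall z, dot z w = 0 -> `|dot z (z *m A)| <= rho * dot z z) ->
  forall x, dot x w = 0 -> dot (x *m A) (x *m A) <= rho ^+ 2 * dot x x.
Proof.
move=> symA wA rho0 Arho x xw.
have Aw : dot (x *m A) w = 0 by rewrite dotC dot_mulmxr symA wA dotC.
set y := rho^-1 *: (x *m A).
have yw : dot y w = 0 by rewrite dotZl Aw mulr0.
have yAx : dot y (x *m A) = rho^-1 * dot (x *m A) (x *m A) by rewrite dotZl.
have xAy : dot x (y *m A) = rho^-1 * dot (x *m A) (x *m A).
  by rewrite (dot_mulmxr x y) symA dotC yAx.
have yy : dot y y = rho^-1 ^+ 2 * dot (x *m A) (x *m A).
  by rewrite /y !dot_lin expr2 mulrA.
clearbody y.
have := Arho (x + y); rewrite dotDl xw yw addr0 => /(_ erefl).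
have := Arho (x - y); rewrite dotDl dotNl xw yw subr0 => /(_ erefl).
rewrite !ler_norml => /andP[h1 _] /andP[_ h2].
move: h1 h2; rewrite !(mulmxDl, mulNmx, dot_lin) !(xAy, yAx, yy) (dotC y x).
set a := dot (x *m A) _; set q := dot x (x *m A); set r := dot y (y *m A).
set xy := dot x y; set xx := dot x x => h1 h2.
(* Adding [h1] and [h2] cancels [q], [r] and [xy]: only the cross term and the parallelogram sum
   remain. *)
have h : 4 * (rho^-1 * a) <= rho * (2 * xx + 2 * (rho^-1 ^+ 2 * a)) by lra.
have e : rho * (rho^-1 ^+ 2 * a) = rho^-1 * a by field; rewrite gt_eqF.
have {}h : rho^-1 * a <= rho * xx by lra.
move: h; rewrite mulrC ler_pdivrMr // => h; lra.
Qed.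

(** The form of [B] is nonnegative at [x - c^-1 *: (x *m B)]; expanding and bounding the quadratic
    term at [x *m B] by [c] gives the claim. It makes an invertible semidefinite [B] coercive. *)
Lemma psd_sqr_le B c : B^T = B -> 0 < c ->
    (forall x, 0 <= dot x (x *m B) <= c * dot x x) ->
  forall x, dot (x *m B) (x *m B) <= c * dot x (x *m B).
Proof.
move=> symB c0 Bc x; set y := x *m B.
have /andP[+ _] := Bc (x - c^-1 *: y).
have /andP[_ yB] := Bc y.
rewrite !(mulmxDl, mulNmx, dot_lin) -!scalemxAl !(dot_lin).
have -> : dot x (y *m B) = dot y y by rewrite dot_mulmxr symB.
rewrite -/y => h.
have yB' : c^-1 * (c^-1 * dot y (y *m B)) <= c^-1 * dot y y.
  by rewrite ler_pM2l ?invr_gt0 // ler_pdivrMl.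
have : c^-1 * dot y y <= dot x y by lra.
by rewrite ler_pdivrMl.
Qed.

(* The least [mu] with [<x, x A> <= mu <x, x>] is an eigenvalue: otherwise
   [mu - A] would be invertible and positive semidefinite, hence bounded below,
   and [mu] could be decreased. *)
Lemma symmetric_eigenvalue_ge A x : A^T = A -> x != 0 ->
  exists mu v, [/\ v != 0, v *m A = mu *: v & dot x (x *m A) <= mu * dot x x].
Proof.
move=> symA x0.
pose S := [set c : R | forall z, dot z (z *m A) <= c * dot z z].
have [d d0 Ad] := mulmx_bounded A.
(* Both [z + z *m A] and [z - z *m A] have nonnegative square norm. *)
have absA z : `|dot z (z *m A)| <= (1 + d) * dot z z.
  have zz := dot_ge0 z; have Az := Ad z; have AA := dot_ge0 (z *m A).
  have := dot_ge0 (z + z *m A); have := dot_ge0 (z - z *m A).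
  rewrite !dot_lin !(dotC (z *m A) z) ler_norml => h1 h2.
  by apply/andP; split; nra.
have S0 : S (1 + d).
  by move=> z; exact: le_trans (ler_norm _) (absA z).
have Slb : lbound S (- (1 + d)).
  move=> c /(_ x) cx; have xx := dot_gt0 x0.
  have := absA x; rewrite ler_norml => /andP[h _].
  have : - (1 + d) * dot x x <= c * dot x x by lra.
  by rewrite ler_pM2r.
have infS : has_inf S by split; [exists (1 + d)|exists (- (1 + d))].
pose mu := inf S.
have Smu : S mu.
  move=> z; have [->|z0] := eqVneq z 0; first by rewrite mul0mx /dot mul0mx mxE mulr0.
  have zz := dot_gt0 z0; rewrite -ler_pdivrMr //.
  apply: lb_le_inf; first by exists (1 + d).
  by move=> c /(_ z); rewrite ler_pdivrMr.
pose B := mu%:M - A.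
have symB : B^T = B by rewrite /B linearB /= tr_scalar_mx symA.
have zB z : z *m B = mu *: z - z *m A by rewrite mulmxBr mul_mx_scalar.
have qB z : dot z (z *m B) = mu * dot z z - dot z (z *m A) by rewrite zB !dot_lin.
have [detB|detB] := eqVneq (\det B) 0.
  have /eqP/det0P[v v0 vB] := detB.
  exists mu, v; split => //.
  by move: vB; rewrite zB => /eqP; rewrite subr_eq0 => /eqP.
exfalso.
pose c := 1 + `|mu| + (1 + d).
have c0 : 0 < c by rewrite /c; have := normr_ge0 mu; lra.
have Bc z : 0 <= dot z (z *m B) <= c * dot z z.
  rewrite qB subr_ge0 (Smu z) /=.
  have := absA z; rewrite ler_norml => /andP[h _].
  have : mu * dot z z <= `|mu| * dot z z by rewrite ler_wpM2r ?dot_ge0 ?ler_norm.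
  have := dot_ge0 z; rewrite /c; lra.
have [k k0 Bk] := mulmx_bounded (invmx B).
have uB : B \in unitmx by rewrite unitmxE unitfE.
have ck : 0 < c * k by rewrite mulr_gt0.
(* Writing [z] as [z *m B *m invmx B] bounds its square norm by [k] times that of [z *m B], which
   [psd_sqr_le] controls by the form of [B]. *)
have low z : dot z z <= c * k * dot z (z *m B).
  have := Bk (z *m B); rewrite mulmxK // => h.
  have := psd_sqr_le symB c0 Bc z; rewrite -(ler_pM2l k0); lra.
have : S (mu - (c * k)^-1).
  move=> z; have := low z.
  rewrite -ler_pdivrMl // qB; lra.
move=> /(ge_inf (proj2 infS)); rewrite -/mu.
have : 0 < (c * k)^-1 by rewrite invr_gt0.
lra.
Qed.

End Dot.

(** * Lebesgue null sets *)

Section Null.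
Variables (R : realType) (n : nat).
Implicit Types (A : set ('I_n -> R)).

Lemma lebesgue_null_subset A B : A `<=` B -> lebesgue_null B -> lebesgue_null A.
Proof.
move=> AB nB e /nB[a [b [ab Bab vol]]]; exists a, b; split => //.
exact: subset_trans AB Bab.
Qed.

(** The set [A m] is covered within [e / 2 ^+ m.+1], and a bijection [g] from [nat] to [nat * nat]
    lists all the boxes in one sequence. *)
Lemma lebesgue_null_bigcup (A : nat -> set ('I_n -> R)) :
  (forall m, lebesgue_null (A m)) -> lebesgue_null (\bigcup_m A m).
Proof.
move=> nA e e0.
have em m : 0 < e / 2 ^+ m.+1 by rewrite divr_gt0 // exprn_gt0.
have /choice[c cP] : forall m, exists c : nat -> ('I_n -> R) * ('I_n -> R),
    [/\ (forall k i, (c k).1 i <= (c k).2 i),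
        A m `<=` \bigcup_k box (c k).1 (c k).2
      & forall N : nat, \sum_(k < N) \prod_(i < n) ((c k).2 i - (c k).1 i)
          <= e / 2 ^+ m.+1].
  move=> m; have [a [b ab]] := nA m _ (em m).
  by exists (fun k => (a k, b k)).
have /card_esym/ppcard_eqP[g] := card_nat2.
pose w (p : nat * nat) := \prod_(i < n) ((c p.1 p.2).2 i - (c p.1 p.2).1 i).
have w0 p : 0 <= w p.
  by apply: prodr_ge0 => i _; rewrite subr_ge0; have [] := cP p.1.
exists (fun k => (c (g k).1 (g k).2).1), (fun k => (c (g k).1 (g k).2).2); split.
- by move=> k i; have [] := cP (g k).1.
- move=> x [m _ Amx]; have [_ /(_ _ Amx)[l _ xl] _] := cP m.
  have [k _ gk] : exists2 k, setT k & g k = (m, l) by apply: (@surj _ _ _ _ g).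
  by exists k => //; rewrite gk.
move=> N; rewrite -/(w _).
(* The first [N] pairs listed by [g] lie in a [B] by [B] square; volumes being nonnegative, the sum
   over the square bounds the partial sum. *)
pose B := (\max_(k < N) maxn (g k).1 (g k).2).+1.
have gB (k : 'I_N) : ((g k).1 < B)%N /\ ((g k).2 < B)%N.
  have := @leq_bigmax _ (fun k : 'I_N => maxn (g k).1 (g k).2) k.
  by rewrite geq_max => /andP[].
pose h (k : 'I_N) : 'I_B * 'I_B := (Ordinal (gB k).1, Ordinal (gB k).2).
have h_inj : injective h.
  move=> k k' [e1 e2]; apply/val_inj/(@inj _ _ _ g); rewrite ?inE //.
  by rewrite [LHS]surjective_pairing e1 e2 -surjective_pairing.
have -> : \sum_(k < N) w (g k) = \sum_(k in 'I_N) w (val (h k).1, val (h k).2).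
  by apply: eq_bigr => k _; rewrite /= -surjective_pairing.
rewrite -(big_imset (fun p : 'I_B * 'I_B => w (val p.1, val p.2))) /=; last first.
  by move=> k k' _ _; exact: h_inj.
apply: (@le_trans _ _ (\sum_(p : 'I_B * 'I_B) w (val p.1, val p.2))).
  rewrite big_mkcond /=; apply: ler_sum => p _; case: ifP => // _; exact: w0.
rewrite -(pair_big predT predT (fun m l : 'I_B => w (val m, val l))) /=.
apply: (@le_trans _ _ (\sum_(m < B) e / 2 ^+ m.+1)).
  by apply: ler_sum => m _; have [_ _] := cP m; exact.
suff -> : \sum_(m < B) e / 2 ^+ m.+1 = e * (1 - 1 / 2 ^+ B).
  rewrite ler_piMr ?ltW // gerBl divr_ge0 //; exact: exprn_ge0.
elim: B {gB h h_inj} => [|B IH]; first by rewrite big_ord0; field.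
rewrite big_ord_recr /= IH exprS; field.
by rewrite expf_neq0.
Qed.

(* [n > 0] makes the padding boxes [{0}] have volume [0]. *)
Lemma lebesgue_null_finite_cover A : (0 < n)%N ->
    (forall eps : R, 0 < eps -> exists (J : finType) (a b : J -> 'I_n -> R),
      [/\ forall j i, a j i <= b j i,
          forall x, A x -> exists j, box (a j) (b j) x
        & \sum_j \prod_(i < n) (b j i - a j i) <= eps]) ->
  lebesgue_null A.
Proof.
move=> n0 cover e /cover[J [a [b [ab Aab vol]]]].
pose f (c : J -> 'I_n -> R) (k : nat) : 'I_n -> R :=
  oapp (fun l : 'I_#|J| => c (enum_val l)) (fun=> 0) (insub k).
exists (f a), (f b); split.
- by move=> k i; rewrite /f; case: insub => /= [l|]; rewrite ?ab.
- move=> x /Aab[j xj]; exists (enum_rank j) => //.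
  by rewrite /f valK /= enum_rankK.
move=> N; apply: le_trans vol.
pose w k := \prod_(i < n) (f b k i - f a k i).
have w0 k : 0 <= w k.
  by apply: prodr_ge0 => i _; rewrite subr_ge0 /f; case: insub => /= [l|]; rewrite ?ab.
(* Lengthening the sum makes it contain every box of [J], whatever [N] is; the terms from [#|J|] on
   vanish. *)
apply: (@le_trans _ _ (\sum_(k < N + #|J|) w k)).
  rewrite big_split_ord /= lerDl sumr_ge0 // => k _; exact: w0.
rewrite addnC big_split_ord /= [X in _ + X]big1 ?addr0; last first.
  move=> k _; rewrite /w (bigD1 (Ordinal n0)) //= /f.
  by rewrite insubF ?subrr ?mul0r //= ltnNge leq_addr.
rewrite [leRHS](reindex (@enum_val J predT)) /=; last first.
  exact/onW_bij/enum_val_bij.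
by apply: ler_sum => k _; rewrite /w /f /= valK.
Qed.

(** Solving for coordinate [k] shows the hyperplane as a Lipschitz graph over the other axes. In a
    bounded cube, a grid of mesh [d] on those axes needs one box of height [2 * D * d] per cell, so
    the total volume is of order [d]. *)
Lemma lebesgue_null_hyperplane (v : 'I_n -> R) : (exists k, v k != 0) ->
  lebesgue_null [set x : 'I_n -> R | \sum_i v i * x i = 0].
Proof.
move=> [k vk].
pose H m := [set x : 'I_n -> R |
  \sum_i v i * x i = 0 /\ forall i, `|x i| < m.+1%:R].
apply: (@lebesgue_null_subset _ (\bigcup_m H m)) => [x vx|].
  exists (\sum_i Num.truncn `|x i|)%N => //; split => // i.
  apply: lt_le_trans (truncnS_gt _) _; rewrite ler_nat ltnS.
  by rewrite (bigD1 i) //= leq_addr.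
apply: lebesgue_null_bigcup => m; apply: lebesgue_null_finite_cover.
  exact: leq_ltn_trans (ltn_ord k).
move=> e e0.
pose c i := - v i / v k.
pose D := \sum_(i | i != k) `|c i|.
have D0 : 0 <= D by apply: sumr_ge0 => i _; exact: normr_ge0.
pose S : R := 2 * m.+1%:R.
have S0 : 0 < S by rewrite mulr_gt0 ?ltr0n.
(* The cover built below has total volume [K / N%:R]. *)
pose K := 2 * D * S * S ^+ #|[pred i | i != k]|.
have K0 : 0 <= K by rewrite !mulr_ge0 ?exprn_ge0 ?(ltW S0) //.
pose N := (Num.truncn (K / e)).+1.
have N0 : 0 < N%:R :> R by rewrite ltr0n.
have KN : K / N%:R <= e.
  by rewrite ler_pdivrMr // mulrC -ler_pdivrMr // ltW // truncnS_gt.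
pose d := S / N%:R.
have d0 : 0 < d by rewrite divr_gt0.
have Nd : N%:R * d = S by rewrite /d mulrC divfK // gt_eqF.
(* Off axis [k], [y f] is the lower corner of the cell [f]; [g f] is the height of the hyperplane
   above that corner. *)
pose y (f : {ffun 'I_n -> 'I_N}) i : R := - m.+1%:R + (f i)%:R * d.
pose g f := \sum_(i | i != k) c i * y f i.
(* Along the [k]-th axis only the index [0] carries a box of positive width;
   this makes the volumes a product over the axes. *)
pose side (i : 'I_n) (j : 'I_N) : R :=
  if i != k then d else if j == ord0 then 2 * D * d else 0.
pose lo f i := if i != k then y f i else g f - D * d.
exists {ffun 'I_n -> 'I_N}, lo, (fun f i => lo f i + side i (f i)); split.
- move=> f i; rewrite lerDl /side; case: ifP => _; first exact: ltW.
  by case: ifP => // _; rewrite !mulr_ge0 ?(ltW d0) //.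
- move=> x [vx xm].
  have jN i : (Num.truncn ((x i + m.+1%:R) / d) < N)%N.
    have := xm i; rewrite ltr_norml => /andP[h1 h2].
    rewrite truncn_lt_nat; last by rewrite divr_ge0 ?(ltW d0) //; lra.
    rewrite ltr_pdivrMr // Nd /S; lra.
  exists [ffun i => if i == k then ord0 else Ordinal (jN i)] => i.
  set f := [ffun _ => _].
  have yx l : l != k -> y f l <= x l <= y f l + d.
    move=> lk; rewrite /y ffunE (negbTE lk) /=.
    have := xm l; rewrite ltr_norml => /andP[h1 h2].
    have : 0 <= (x l + m.+1%:R) / d by rewrite divr_ge0 ?(ltW d0) //; lra.
    move=> /truncn_itv/andP[]; rewrite ler_pdivlMr // ltr_pdivrMr //.
    by set t := Num.truncn _; rewrite -[t.+1%:R]natr1 mulrDl mul1r => h3 h4; apply/andP; split; lra.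
  rewrite /lo /side; case: ifPn => [ik|]; first exact: yx.
  rewrite negbK => /eqP ->; rewrite ffunE !eqxx.
  have xk : x k = \sum_(i | i != k) c i * x i.
    move: vx; rewrite /= (bigD1 k) //= => /eqP; rewrite addr_eq0 => /eqP vx.
    apply: (mulfI vk); rewrite vx mulr_sumr -sumrN; apply: eq_bigr => l _.
    by rewrite /c; field.
  have : `|x k - g f| <= D * d.
    rewrite xk /g -sumrB /D mulr_suml; apply: le_trans (ler_norm_sum _ _ _) _.
    apply: ler_sum => l lk; rewrite -mulrBr normrM ler_wpM2l //.
    by have /andP[h1 h2] := yx l lk; rewrite ger0_norm; lra.
  rewrite ler_norml => /andP[h1 h2]; apply/andP; split; lra.
(* The sum over all [f] of products of sides factors into a product over axes: [S] for each axis
   other than [k], and [2 * D * d] for [k]. *)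
under eq_bigr => f _ do under eq_bigr => i _ do rewrite addrAC subrr add0r.
rewrite -bigA_distr_bigA /= (bigD1 k) //=.
rewrite /side eqxx /= -big_mkcond /= big_pred1_eq.
under eq_bigr => i ik do rewrite ik sumr_const card_ord -mulr_natl Nd.
rewrite prodr_const; apply: le_trans KN.
by rewrite /K /d le_eqVlt; apply/orP; left; apply/eqP; field; rewrite gt_eqF.
Qed.
End Null.

(** * Growth of geometric sequences *)

Lemma Bernoulli_expr (R : realDomainType) (h : R) (t : nat) :
  0 <= h -> 1 + t%:R * h <= (1 + h) ^+ t.
Proof.
move=> h0; elim: t => [|t IH]; first by rewrite mul0r addr0 expr0.
rewrite exprS -natr1; have : 0 <= t%:R :> R by rewrite ler0n.
by nra.
Qed.

Lemma geometric_cvgy (R : realType) (c mu : R) : 0 < c -> 1 < mu ->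
  (fun t => mu ^+ t * c) @ \oo --> +oo.
Proof.
move=> c0 mu1; apply/cvgryPge => A.
have h0 : 0 < mu - 1 by rewrite subr_gt0.
exists (Num.truncn (A / (c * (mu - 1)))).+1 => // t /= Nt.
have := Bernoulli_expr t (ltW h0); rewrite [X in X ^+ t]addrC subrK => B.
have : A / (c * (mu - 1)) < t%:R.
  by apply: lt_le_trans (truncnS_gt _) _; rewrite ler_nat.
rewrite ltr_pdivrMr ?mulr_gt0 // => At.
have : (1 + t%:R * (mu - 1)) * c <= mu ^+ t * c by rewrite ler_pM2r.
lra.
Qed.

(** * Signed Laplacian dynamics *)

Section Laplacian.
Variables (R : realType) (n : nat).
Implicit Types (E : rel 'I_n) (x : 'rV[R]_n).

(* Adjacency minus degree: the negative of the usual Laplacian. *)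
Definition lapmx E : 'M[R]_n :=
  \matrix_(i, j) ((E i j)%:R - (i == j)%:R * (degp E i)%:R).

(** For symmetric [E] each edge occurs as two ordered pairs, whence the division by 2. *)
Definition energy E x : R :=
  (\sum_i \sum_(j | E i j) (x 0 j - x 0 i) ^+ 2) / 2.

Lemma degpE E i : degp E i = #|E i|.
Proof. by apply: eq_card => j; apply/idP/idP; rewrite inE. Qed.

Lemma tr_lapmx E : symmetric E -> (lapmx E)^T = lapmx E.
Proof.
move=> symE; apply/matrixP => i j; rewrite !mxE symE eq_sym.
by have [->|_] := eqVneq i j; rewrite ?mul0r.
Qed.

Lemma mulmx_lapmx E x i : symmetric E ->
  (x *m lapmx E) 0 i = \sum_(j | E i j) (x 0 j - x 0 i).
Proof.
move=> symE; rewrite mxE sumrB sumr_const -mulr_natr.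
under eq_bigr => j _ do rewrite mxE mulrBr.
rewrite sumrB; congr (_ - _).
  rewrite [RHS]big_mkcond /=; apply: eq_bigr => j _; rewrite symE.
  by case: (E i j); rewrite ?mulr1 ?mulr0.
rewrite (bigD1 i) //= eqxx mul1r degpE big1 ?addr0 // => j ji.
by rewrite (negbTE ji) mul0r mulr0.
Qed.

Lemma dot_lapmx E x : symmetric E -> dot x (x *m lapmx E) = - energy E x.
Proof.
move=> symE; rewrite dotE.
under eq_bigr => i _ do rewrite mulmx_lapmx // mulr_sumr.
set S := \sum_i _.
(* Exchanging the ends of every edge gives a second form of [S]; the two forms add up to minus the
   squared differences. *)
have S' : S = \sum_i \sum_(j | E i j) x 0 j * (x 0 i - x 0 j).
  rewrite /S (exchange_big_dep predT) //=; apply: eq_bigr => i _.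
  by apply: eq_bigl => j; rewrite symE.
suff : S + S = - (energy E x + energy E x) by lra.
rewrite [X in _ + X]S' /energy -splitr /S -big_split -sumrN.
apply: eq_bigr => i _; rewrite -big_split -sumrN; apply: eq_bigr => j _ /=.
by ring.
Qed.

Lemma energy_ge0 E x : 0 <= energy E x.
Proof.
rewrite divr_ge0 // sumr_ge0 // => i _; rewrite sumr_ge0 // => j _.
exact: sqr_ge0.
Qed.

Lemma energy_ge_edge E x i j : E i j -> (x 0 j - x 0 i) ^+ 2 <= 2 * energy E x.
Proof.
move=> Eij; rewrite mulrC divfK // (bigD1 i) //= (bigD1 j) //= -addrA lerDl.
by rewrite addr_ge0 ?sumr_ge0 // => *; rewrite ?sumr_ge0 // => *; exact: sqr_ge0.
Qed.

(** Each squared difference is at most twice the sum of the two squares, and a vertex occurs once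
    per incident edge. This is where the bound on [alpha] enters, to keep the form of the update
    matrix above [- rho]. *)
Lemma energy_le E x : symmetric E ->
  energy E x <= 2 * (maxdegp E)%:R * dot x x.
Proof.
move=> symE; rewrite ler_pdivrMr //.
have xx i : (degp E i)%:R * x 0 i ^+ 2 <= (maxdegp E)%:R * x 0 i ^+ 2.
  rewrite ler_wpM2r ?sqr_ge0 // ler_nat; exact: (@leq_bigmax _ (degp E) i).
have deg : \sum_i \sum_(j | E i j) x 0 i ^+ 2 <= (maxdegp E)%:R * dot x x.
  rewrite dotE mulr_sumr; apply: ler_sum => i _.
  by rewrite sumr_const -expr2 (le_trans _ (xx i)) // degpE mulr_natl.
have deg' : \sum_i \sum_(j | E i j) x 0 j ^+ 2 <= (maxdegp E)%:R * dot x x.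
  apply: le_trans deg; rewrite (exchange_big_dep predT) //= le_eqVlt.
  apply/orP; left; apply/eqP; apply: eq_bigr => i _.
  by apply: eq_bigl => j; rewrite symE.
apply: (@le_trans _ _ (2 * (\sum_i \sum_(j | E i j) x 0 j ^+ 2)
                     + 2 * (\sum_i \sum_(j | E i j) x 0 i ^+ 2))); last by lra.
rewrite !mulr_sumr -big_split; apply: ler_sum => i _.
rewrite !mulr_sumr -big_split; apply: ler_sum => j _ /=.
have := sqr_ge0 (x 0 j + x 0 i); lra.
Qed.

Lemma connect_diff_le E x i j : connect E i j ->
  `|x 0 j - x 0 i| <= n%:R * Num.sqrt (2 * energy E x).
Proof.
(* A path without repeated vertices has fewer than [n] edges, each contributing at most [s]. *)
move=> /connectP[p ip ->]; case: (shortenP ip) => {ip}p ip up _.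
set s := Num.sqrt _.
apply: (@le_trans _ _ ((size p)%:R * s)); last first.
  rewrite ler_wpM2r ?sqrtr_ge0 // ler_nat; apply: ltnW.
  by rewrite -[leqLHS]/(size (i :: p)) -(card_uniqP up) -[leqRHS](card_ord n) max_card.
elim: p i ip {up} => [|k p IH] i /=; first by rewrite subrr normr0 mul0r.
move=> /andP[ik kp]; have := IH k kp; set l := last k p => h.
have ks : `|x 0 k - x 0 i| <= s.
  by rewrite -sqrtr_sqr ler_sqrt ?energy_ge_edge // mulr_ge0 ?energy_ge0.
have -> : x 0 l - x 0 i = (x 0 l - x 0 k) + (x 0 k - x 0 i) by ring.
apply: le_trans (ler_normD _ _) _; rewrite -natr1; lra.
Qed.

(** For sum zero, [n%:R * x 0 i] is the sum of the differences [x 0 i - x 0 j], each bounded along a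
    path. The constant is crude; only its finiteness matters. *)
Lemma Poincare_le E x : (forall i j, connect E i j) -> \sum_i x 0 i = 0 ->
  dot x x <= 2 * n%:R ^+ 3 * energy E x.
Proof.
move=> connE sx; set s := Num.sqrt (2 * energy E x).
have xs i : `|x 0 i| <= n%:R * s.
  have n0 : 0 < n%:R :> R by rewrite ltr0n (leq_ltn_trans _ (ltn_ord i)).
  rewrite -(ler_pM2l n0) -[X in X * `|_|]gtr0_norm // -normrM.
  have -> : n%:R * x 0 i = \sum_j (x 0 i - x 0 j).
    by rewrite sumrB sx subr0 sumr_const card_ord mulr_natl.
  apply: le_trans (ler_norm_sum _ _ _) _.
  apply: (@le_trans _ _ (\sum_(j < n) n%:R * s)); last first.
    by rewrite sumr_const card_ord [leRHS]mulr_natl.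
  by apply: ler_sum => j _; exact: connect_diff_le.
rewrite dotE; apply: (@le_trans _ _ (\sum_(i < n) (n%:R * s) ^+ 2)).
  apply: ler_sum => i _; rewrite -expr2 -real_normK ?num_real //.
  by rewrite ler_sqr ?nnegrE ?mulr_ge0 ?sqrtr_ge0.
rewrite sumr_const card_ord -mulr_natl exprMn sqr_sqrtr ?(mulr_ge0 _ (energy_ge0 E x)) //.
by rewrite le_eqVlt; apply/orP; left; apply/eqP; ring.
Qed.

Lemma dot_ones x : dot x (const_mx 1) = \sum_i x 0 i.
Proof. by rewrite dotE; apply: eq_bigr => i _; rewrite mxE mulr1. Qed.

End Laplacian.

(** * The update matrix, convergence and divergence *)

Section Dynamics.
Variables (R : realType) (n : nat) (Ep Em : rel 'I_n).
Hypotheses (Ep_sym : symmetric Ep) (Em_sym : symmetric Em).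
Implicit Types (a b : R) (x : 'rV[R]_n).

Definition stepmx a b : 'M[R]_n := 1%:M + a *: lapmx R Ep - b *: lapmx R Em.

Lemma tr_stepmx a b : (stepmx a b)^T = stepmx a b.
Proof. by rewrite /stepmx !linearD !linearN !linearZ /= trmx1 !tr_lapmx. Qed.

Lemma mulmx_stepmx a b x :
  x *m stepmx a b = x + a *: (x *m lapmx R Ep) - b *: (x *m lapmx R Em).
Proof. by rewrite /stepmx mulmxBr mulmxDr mulmx1 !scalemxAr. Qed.

Lemma dot_stepmx a b x :
  dot x (x *m stepmx a b) = dot x x - a * energy Ep x + b * energy Em x.
Proof. by rewrite mulmx_stepmx !dot_lin !dot_lapmx //; ring. Qed.

Lemma stepmxE a b x i : (x *m stepmx a b) 0 i =
  x 0 i + a * (\sum_(j | Ep i j) (x 0 j - x 0 i))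
        - b * (\sum_(j | Em i j) (x 0 j - x 0 i)).
Proof.
rewrite mulmx_stepmx -!mulmx_lapmx //.
by move: (x *m lapmx R Ep) (x *m lapmx R Em) => u w; rewrite !mxE.
Qed.

Lemma ones_stepmx a b :
  const_mx 1 *m stepmx a b = const_mx 1 :> 'rV[R]_n.
Proof.
apply/rowP => i; rewrite stepmxE !big1 ?mulr0 ?addr0 ?subr0 // => j _;
  by rewrite !mxE subrr.
Qed.

Lemma row_traj a b (x : 'I_n -> R) t :
  \row_i traj Ep Em a b x t.+1 i = (\row_i traj Ep Em a b x t i) *m stepmx a b.
Proof.
apply/rowP => i; rewrite stepmxE !mxE /traj /= {1}/step.
by congr (_ + _ * _ - _ * _); apply: eq_bigr => j _; rewrite !mxE.
Qed.

Lemma traj_cvg_avg a b (rho : R) : (0 < n)%N -> 0 < rho < 1 ->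
    (forall x, \sum_i x 0 i = 0 ->
      `|dot x (x *m stepmx a b)| <= rho * dot x x) ->
  forall (x : 'I_n -> R) i, (fun t => traj Ep Em a b x t i) @ \oo --> avg x.
Proof.
move=> n0 /andP[rho0 rho1] Arho x i.
have nz : n%:R != 0 :> R by rewrite pnatr_eq0 -lt0n.
pose y t : 'rV[R]_n := \row_j traj Ep Em a b x t j - avg x *: const_mx 1.
have yS t : y t.+1 = y t *m stepmx a b.
  by rewrite /y row_traj mulmxBl -scalemxAl ones_stepmx.
(* The update matrix is symmetric and fixes the constants, so it preserves their orthogonal
   complement. *)
have y_ones t : dot (y t) (const_mx 1) = 0.
  elim: t => [|t IH]; last by rewrite yS dotC dot_mulmxr tr_stepmx ones_stepmx dotC.
  rewrite dot_ones; under eq_bigr => j _ do rewrite !mxE mulr1.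
  by rewrite sumrB sumr_const card_ord -mulr_natr /avg divfK ?subrr.
have contr := numerical_radius_contraction (tr_stepmx a b) (ones_stepmx a b) rho0.
have yt t : dot (y t) (y t) <= (rho ^+ t) ^+ 2 * dot (y 0%N) (y 0%N).
  elim: t => [|t IH]; first by rewrite expr0 expr1n mul1r.
  rewrite yS; apply: le_trans (contr _ _ (y_ones t)) _.
    by move=> z; rewrite dot_ones; exact: Arho.
  by rewrite (exprS rho t) exprMn -[leRHS]mulrA ler_wpM2l ?sqr_ge0.
set c := Num.sqrt (dot (y 0%N) (y 0%N)).
have bound t : `|traj Ep Em a b x t i - avg x| <= c * rho ^+ t.
  have -> : traj Ep Em a b x t i - avg x = y t 0 i by rewrite !mxE mulr1.
  rewrite -sqrtr_sqr mulrC -[rho ^+ t]ger0_norm ?exprn_ge0 ?(ltW rho0) //.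
  rewrite -sqrtr_sqr -sqrtrM ?sqr_ge0 // ler_wsqrtr //.
  exact: le_trans (sqr_coord_le_dot _ _) (yt t).
have geo : (fun t => c * rho ^+ t) @ \oo --> (0 : R).
  by apply: cvg_geometric; rewrite gtr0_norm.
apply/cvgrPdist_lt => e e0.
move/cvgrPdist_lt: geo => /(_ e e0).
apply: filterS => t; rewrite sub0r normrN => ct.
by rewrite distrC; apply: le_lt_trans (bound t) _; apply: le_lt_trans (ler_norm _) ct.
Qed.

Lemma traj_diverge a b x : dot x x < dot x (x *m stepmx a b) ->
  lebesgue_null [set x0 : 'I_n -> R |
    ~ ((fun t => eucl_norm (traj Ep Em a b x0 t)) @ \oo --> +oo)].
Proof.
move=> xAx.
have x0 : x != 0.
  by apply: contraTneq xAx => ->; rewrite mul0mx ltxx.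
have [mu [v [v0 vA xmu]]] := symmetric_eigenvalue_ge (tr_stepmx a b) x0.
have mu1 : 1 < mu.
  rewrite -(ltr_pM2r (dot_gt0 x0)) mul1r; exact: lt_le_trans xAx xmu.
apply: (@lebesgue_null_subset _ _ _ [set z | \sum_i v 0 i * z i = 0]); last first.
  apply: lebesgue_null_hyperplane; have /rV0Pn[k vk] := v0; by exists k.
move=> z /= ndiv; apply/eqP; apply: contra_notT ndiv => vz.
pose u t : 'rV[R]_n := \row_i traj Ep Em a b z t i.
(* The component along [v] is multiplied by [mu] at each step; Cauchy-Schwarz then bounds the norm
   from below. *)
have ut t : dot v (u t) = mu ^+ t * dot v (u 0%N).
  elim: t => [|t IH]; first by rewrite expr0 mul1r.
  by rewrite {1}/u row_traj dot_mulmxr tr_stepmx vA dotZl IH exprS mulrA.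
have vu0 : dot v (u 0%N) != 0.
  by rewrite dotE; under eq_bigr => i _ do rewrite mxE.
have vv : 0 < Num.sqrt (dot v v) by rewrite sqrtr_gt0 dot_gt0.
apply: (@ger_cvgy _ _ _ _
  (fun t => mu ^+ t * (`|dot v (u 0%N)| / Num.sqrt (dot v v)))); last first.
  by apply: geometric_cvgy => //; rewrite divr_gt0 ?normr_gt0.
apply: nearW => t; rewrite mulrA ler_pdivrMr //.
have mut : 0 <= mu ^+ t by rewrite exprn_ge0 // ltW // (lt_trans ltr01).
rewrite -[mu ^+ t]ger0_norm // -normrM -ut -sqrtr_sqr.
have -> : eucl_norm (traj Ep Em a b z t) = Num.sqrt (dot (u t) (u t)).
  by rewrite /eucl_norm dotE; under [in RHS]eq_bigr => i _ do rewrite !mxE -expr2.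
rewrite -sqrtrM ?dot_ge0 // ler_wsqrtr // mulrC; exact: dot_Cauchy_Schwarz.
Qed.

End Dynamics.

(** * The critical value as an infimum of energy ratios *)

Theorem theorem4p1 (R : realType) (n : nat) (Ep Em : rel 'I_n)
  (Ep_sym : symmetric Ep) (Em_sym : symmetric Em)
  (Ep_irr : irreflexive Ep) (Em_irr : irreflexive Em)
  (E_disj : forall i j, ~~ (Ep i j && Em i j))
  (Ep_conn : forall i j, connect Ep i j)
  (Em_ne : exists i j, Em i j)
  (alpha : R) (alpha_gt0 : 0 < alpha)
  (alpha_lt : alpha < 1 / (maxdegp Ep)%:R) :
  exists beta_star : R, 0 <= beta_star /\
    (forall beta : R, 0 <= beta -> beta < beta_star ->
       forall (x0 : 'I_n -> R) (i : 'I_n),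
         (fun t : nat => traj Ep Em alpha beta x0 t i) @ \oo --> avg x0) /\
    (forall beta : R, beta_star < beta ->
       lebesgue_null
         [set x0 : 'I_n -> R |
            ~ ((fun t : nat => eucl_norm (traj Ep Em alpha beta x0 t)) @ \oo --> +oo)]).
Proof.
have [i0 [j0 Em0]] := Em_ne.
pose Q := [set alpha * energy Ep x / energy Em x | x in
  [set x : 'rV[R]_n | 0 < energy Em x]].
have Qlb : lbound Q 0.
  move=> _ [x x0 <-]; exact: divr_ge0 (mulr_ge0 (ltW alpha_gt0) (energy_ge0 _ _)) (energy_ge0 _ _).
have Q0 : Q !=set0.
  (* The indicator of one end of a negative edge has positive negative energy, as the edge is not a
     loop. *)
  pose x : 'rV[R]_n := delta_mx 0 i0.
  exists (alpha * energy Ep x / energy Em x), x => //=.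
  have := energy_ge_edge x Em0; have /negbTE ji : j0 != i0.
    by apply: contraTneq Em0 => ->; rewrite Em_irr.
  rewrite !mxE !eqxx ji /= sub0r sqrrN expr1n; lra.
have infQ : has_inf Q by split=> //; exists 0.
exists (inf Q); split; first exact: lb_le_inf.
split=> [beta beta0 beta_lt|beta beta_gt].
  pose d : R := (maxdegp Ep)%:R.
  have d0 : 0 < d.
    (* If the maximal degree were 0, then [1 / 0 = 0] would contradict [0 < alpha]. *)
    rewrite lt_def ler0n andbT; apply: contraTneq alpha_lt => d0.
    by rewrite -/d d0 invr0 mulr0 -leNgt ltW.
  have ad : alpha * d < 1 by rewrite -ltr_pdivlMr.
  have n0 : (0 < n)%N := leq_ltn_trans (leq0n _) (ltn_ord i0).
  pose b := inf Q.
  have b0 : 0 < b := le_lt_trans beta0 beta_lt.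
  have bQ (x : 'rV[R]_n) : b * energy Em x <= alpha * energy Ep x.
    have [xm|xm] := ltP 0 (energy Em x); last first.
      have -> : energy Em x = 0 by apply/eqP; rewrite eq_le xm energy_ge0.
      by rewrite mulr0; exact: mulr_ge0 (ltW alpha_gt0) (energy_ge0 _ _).
    rewrite -ler_pdivlMr //; apply: ge_inf; first by exists 0.
    by exists x.
  pose P : R := 2 * n%:R ^+ 3.
  have P0 : 0 < P by rewrite mulr_gt0 // exprn_gt0 // ltr0n.
  pose s := alpha * (1 - beta / b) / P.
  have s0 : 0 < s.
    by rewrite divr_gt0 // mulr_gt0 // subr_gt0 ltr_pdivrMr // mul1r.
  (* The first term serves the upper bound on the form (Poincare inequality), the second the lower
     bound (degree bound), and [1 / 2] makes [rho] positive. *)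
  pose rho := Num.max (1 - s) (Num.max (2 * (alpha * d) - 1) (1 / 2)).
  have [r1 r2 r3] : [/\ 1 - s <= rho, 2 * (alpha * d) - 1 <= rho & 1 / 2 <= rho].
    by rewrite !le_max !lexx !orbT.
  apply: (@traj_cvg_avg _ _ _ _ _ _ _ _ rho) => //.
    apply/andP; split; first by lra.
    by rewrite !gt_max; apply/and3P; split; lra.
  move=> x sx; rewrite dot_stepmx // ler_norml.
  have Px := Poincare_le Ep_conn sx; have ex := energy_le x Ep_sym.
  have bx := bQ x; have em := energy_ge0 Em x; have xx := dot_ge0 x.
  rewrite -/P in Px; rewrite -/d in ex.
  have bb : beta * energy Em x <= beta / b * (alpha * energy Ep x).
    by rewrite -mulrA ler_wpM2l // ler_pdivlMl.
  have sE : s * dot x x <= alpha * (1 - beta / b) * energy Ep x.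
    have sP : s * P = alpha * (1 - beta / b) by rewrite /s divfK // gt_eqF.
    by rewrite -sP -mulrA ler_pM2l.
  have aE : alpha * energy Ep x <= 2 * (alpha * d) * dot x x.
    have := ex; rewrite -(ler_pM2l alpha_gt0); lra.
  have bE : 0 <= beta * energy Em x by rewrite mulr_ge0.
  have h1 : (1 - s) * dot x x <= rho * dot x x by rewrite ler_wpM2r.
  have h2 : (2 * (alpha * d) - 1) * dot x x <= rho * dot x x by rewrite ler_wpM2r.
  by apply/andP; split; lra.
(* Some energy ratio lies below [beta], and its vector [x] has [<x, x A> > |x|^2]. *)
have [_ [x xm <-] xb] := inf_lt Q0 beta_gt.
apply: (@traj_diverge _ _ _ _ _ _ _ _ x) => //.
rewrite dot_stepmx //.
by move: xb; rewrite ltr_pdivrMr //; lra.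
Qed.
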